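(* Let $k \ge 3$, let $0 \le v < \lvert I_{k-2}\rvert$, and let $0 \le u \le 2^{k-1}-b_k$ be integers. Then $$Z(a_k+v)=Z(a_{k-2}+v)+1,$$ $$Z(b_k+u)=Z(a_{k-1}+u)+1,$$ $$Z(2^k-(b_k+u))=Z(a_{k-1}+u)+1,$$ $$Z(c_k+v)=Z(2^{k-2}-(a_{k-2}+v))+1.$$
   Context: A BSD representation of an integer $n$ is a digit string $(b_{m-1}\cdots b_0)$ with $b_j\in\{1,0,-1\}$ and $n=\sum b_j2^j$; its Hamming weight is the number of nonzero digits. A non-adjacent form (NAF) is a BSD representation in which no two adjacent digits are both nonzero; it is reduced if its leading digit is nonzero. Every positive integer has exactly one reduced NAF; its length is the NAF-bitlength of $n$. $I_k$ denotes the set of positive integers of NAF-bitlength $k$; it is a set of consecutive integers (e.g. $I_1=\{1\}$, $I_2=\{2\}$, $I_3=\{3,4,5\}$), and for $k\ge3$, $\lvert I_k\rvert=2\lvert I_{k-2}\rvert+\lvert I_{k-1}\rvert$. A BSD representation of $n\in I_k$ of length $k$ is optimal if it has the same Hamming weight as the reduced NAF of $n$; $Z(n)$ denotes the number of $0$ digits in an optimal representation of $n$ (equivalently in the reduced NAF of $n$). Write $a_k=\min I_k$ for $k\ge1$ and $a_0=0$ (equivalently $a_1=1,a_2=2$, $a_k=2^{k-2}+a_{k-2}$). For $k\ge3$, $I_k$ is partitioned into consecutive subintervals $\mathcal{A}_k$ (first $\lvert I_{k-2}\rvert$ elements), $\mathcal{B}_k$ (next $\lvert I_{k-1}\rvert$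 elements), $\mathcal{C}_k$ (last $\lvert I_{k-2}\rvert$ elements), with minima $a_k$, $b_k=a_k+\lvert I_{k-2}\rvert$, $c_k=b_k+\lvert I_{k-1}\rvert=2^{k-1}+a_{k-2}$. *)

(* Defs.v *)
From mathcomp Require Export all_boot all_order all_algebra.
From mathcomp Require Export finmap.
From mathcomp Require Export boolp classical_sets cardinality.

Set Implicit Arguments.
Unset Strict Implicit.
Unset Printing Implicit Defensive.

Import Order.TTheory GRing.Theory Num.Theory.

Local Open Scope classical_set_scope.
Local Open Scope ring_scope.

(* Digit strings are little-endian: the string (b_{m-1} ... b_0) is the
   sequence [:: b_0; ...; b_{m-1}], so that its leading digit is its last
   element. The empty string is not reduced. *)
Definition bsd (n : int) : set (seq int) :=
  [set s | (forall d, d \in s -> d = 1 \/ d = 0 \/ d = -1) /\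
           n = \sum_(j < size s) s`_j * 2 ^+ j].

Definition weight (s : seq int) : nat := count (fun d => d != 0) s.

Definition naf (n : int) : set (seq int) :=
  [set s | bsd n s /\
           forall j, (j.+1 < size s)%N -> ~ (s`_j != 0 /\ s`_j.+1 != 0)].

Definition is_reduced_naf (n : int) : set (seq int) :=
  [set s | naf n s /\ last 0 s != 0].

(* [xget x0 A] is an element of A, and x0 if A is empty; the default values
   below are never reached for n > 0 (here and in Z) and k > 0 (in a_). *)
Definition reduced_naf (n : int) : seq int := xget [::] (is_reduced_naf n).

Definition naf_bitlength (n : int) : nat := size (reduced_naf n).

Definition NAFI (k : nat) : set int := [set n | 0 < n /\ naf_bitlength n = k].

Definition cardI (k : nat) : nat := #|` fset_set (NAFI k)|%fset.

Definition optimal (n : int) : set (seq int) :=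
  [set s | [/\ bsd n s, size s = naf_bitlength n
             & weight s = weight (reduced_naf n)]].

Definition Z (n : int) : nat := count_mem 0 (xget [::] (optimal n)).

Lemma Z_optimal (n : int) (s : seq int) : optimal n s -> Z n = count_mem 0 s.
Proof.
move=> os; rewrite /Z; have [_ s1 w1] := os.
have [_ s2 w2] := xgetPex [::] (ex_intro _ s os).
set t := xget _ _ in s2 w2 *.
have := count_predC (pred1 (0 : int)) t; have := count_predC (pred1 (0 : int)) s.
rewrite s1 s2 -/(weight s) -/(weight t) w1 w2 => <-.
exact: addIn.
Qed.

Definition a_ (k : nat) : int :=
  if k is 0%N then 0 else xget 0 (NAFI k `&` lbound (NAFI k)).

(* Minima of the middle and last blocks of NAFI k; meaningful for k >= 3. *)
Definition b_ (k : nat) : int := a_ k + (cardI (k - 2))%:Z.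

Definition c_ (k : nat) : int := b_ k + (cardI (k - 1))%:Z.

(* Main.v *)
Require Import Defs.
From mathcomp Require Import all_boot all_order all_algebra.
From mathcomp Require Import zify.

(** NAFs are unique, because a NAF's two lowest digits are determined by the
    number modulo 4. With alpha_0 = 1 and alpha_(m+1) = 2^m + 1 - alpha_m, every
    r with |r| < alpha_m has a NAF s of length m with top digit 0, so the reduced
    NAF of 2^m + r is 1 followed by s; as the intervals |n - 2^m| < alpha_m tile
    the positive integers, they are exactly the I_(m+1).  Negating s, inserting a
    0 below the leading digit, or putting "1 0" in front of a reduced NAF then
    gives the four identities. *)

Set Implicit Arguments.
Unset Strict Implicit.
Unset Printing Implicit Defensive.

Import Order.TTheory GRing.Theory Num.Theory.

Local Open Scope classical_set_scope.
Local Open Scope ring_scope.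

(** * Operations on NAFs *)

Lemma naf_nil : naf 0 [::].
Proof. by split; [split=> //=; rewrite big_ord0 | ]. Qed.

Lemma naf_rcons (r : int) (s : seq int) (d : int) :
  naf r s -> d = 1 \/ d = 0 \/ d = -1 -> d = 0 \/ last 0 s = 0 ->
  naf (r + d * 2 ^+ size s) (rcons s d).
Proof.
move=> [[ds ->] nadj] dd dl; split; first split.
- by move=> e; rewrite mem_rcons inE => /orP[/eqP->//|/ds].
- rewrite size_rcons big_ord_recr /= nth_rcons ltnn eqxx; congr (_ + _).
  by apply: eq_bigr => j _; rewrite nth_rcons ltn_ord.
- move=> j; rewrite size_rcons ltnS leq_eqVlt => /orP[/eqP sj|js].
    rewrite !nth_rcons -sj ltnSn ltnn eqxx => -[sj0 d0].
    case: dl => [d_eq|]; first by rewrite d_eq eqxx in d0.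
    by move/eqP; rewrite -nth_last -sj /= (negbTE sj0).
  by rewrite !nth_rcons js (ltnW js); exact: nadj.
Qed.

Lemma naf_opp (r : int) (s : seq int) : naf r s -> naf (- r) (map -%R s).
Proof.
move=> [[ds ->] nadj]; split; first split.
- by move=> _ /mapP[d /ds dd ->]; lia.
- rewrite size_map -sumrN; apply: eq_bigr => j _.
  by rewrite (nth_map 0) // mulNr.
- move=> j; rewrite size_map => js.
  rewrite !(nth_map 0) ?(ltnW js) // !oppr_eq0; exact: nadj.
Qed.

(** Digits past the end read as the default 0, so no bound on [j] is needed. *)
Lemma naf_nth (n : int) (s : seq int) (j : nat) :
  naf n s -> [/\ s`_j = 1 \/ s`_j = 0 \/ s`_j = -1 & s`_j = 0 \/ s`_j.+1 = 0].
Proof.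
move=> [[ds _] nadj]; split.
  have [js|sj] := ltnP j (size s); first exact/ds/mem_nth.
  by rewrite nth_default; [right; left|].
have [js|sj] := ltnP j.+1 (size s); last by right; rewrite nth_default.
have := nadj _ js.
case: (eqVneq s`_j 0) => [->|_]; first by left.
case: (eqVneq s`_j.+1 0) => [->|_]; first by right.
by move=> nn; case: nn.
Qed.

(** * Uniqueness of the reduced NAF *)

Lemma naf_behead (n : int) (s : seq int) :
  naf n s -> exists2 n', n = s`_0 + 2 * n' & naf n' (behead s).
Proof.
case: s => [|d s] [[ds ->] nadj].
  by exists 0; [rewrite big_ord0 | exact: naf_nil].
exists (\sum_(j < size s) s`_j * 2 ^+ j).
  rewrite /= big_ord_recl /= mulr1 mulr_sumr; congr (_ + _).
  by apply: eq_bigr => j _; rewrite /= exprS mulrCA.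
split; first by split=> // e es; apply: ds; rewrite inE es orbT.
by move=> j js; exact: (nadj j.+1).
Qed.

(** Equality holds only digit by digit, since a NAF may carry leading zeros. *)
Lemma naf_nth_inj (n : int) (s t : seq int) :
  naf n s -> naf n t -> forall j, s`_j = t`_j.
Proof.
move=> ns nt j; elim: j => [|j IH] in n s t ns nt *;
  have [n1 ns1 ns'] := naf_behead ns; have [m1 nt1 nt'] := naf_behead nt;
  have st0 : s`_0 = t`_0.
(* Both copies of [st0]: an even [n] forces the lowest digit 0; for odd [n] the next digit is 0, so
   the lowest one is 1 or -1 according to [n] modulo 4. *)
1,3: have [n2 ns2 _] := naf_behead ns'; have [m2 nt2 _] := naf_behead nt';
  have [ds as_] := naf_nth 0 ns; have [dt at_] := naf_nth 0 nt;
  by rewrite !nth_behead in ns2 nt2; lia.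
  exact: st0.
have nm : n1 = m1 by lia.
by rewrite -!nth_behead; apply: IH ns' _; rewrite nm.
Qed.

Lemma reduced_naf_unique (n : int) (s : seq int) :
  is_reduced_naf n s -> reduced_naf n = s.
Proof.
(* [t2] must reach as far as the nonzero leading digit of [t1]. *)
have le_size (t1 t2 : seq int) : (forall j, t1`_j = t2`_j) ->
    last 0 t1 != 0 -> (size t1 <= size t2)%N.
  move=> eqt; rewrite -nth_last eqt leqNgt; apply: contra => lt21.
  by rewrite nth_default //; case: (size t1) lt21.
move=> rs; have [ns ls] := rs.
have [nt lt] := xgetPex [::] (ex_intro _ s rs).
rewrite -/(reduced_naf n) in nt lt.
have eqd := naf_nth_inj nt ns.
apply: (@eq_from_nth _ 0) => [|j _ //].
by apply/eqP; rewrite eqn_leq !le_size.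
Qed.

(** * The sequence [alpha] and existence of NAFs *)

(* The minimum of NAFI k, except for the convention alpha 0 = 1. *)
Fixpoint alpha (k : nat) : int :=
  if k is m.+1 then 2 ^+ m + 1 - alpha m else 1.

Arguments alpha k : simpl never.

Lemma alphaS (m : nat) : alpha m.+1 = 2 ^+ m + 1 - alpha m.
Proof. by []. Qed.

(** The recursion of the minima; with [alpha 0 = 1] it already holds at [m = 0]. *)
Lemma alphaSS (m : nat) : alpha m.+2 = 2 ^+ m + alpha m.
Proof. by rewrite !alphaS exprS; lia. Qed.

Lemma alpha_bounds (m : nat) : 1 <= alpha m <= 2 ^+ m.
Proof. by elim: m => // m IH; rewrite alphaS exprS; lia. Qed.

Lemma alphaS_lt (m : nat) : alpha m.+1 < alpha m.+2.
Proof. by have := alpha_bounds m; rewrite alphaSS alphaS; lia. Qed.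

(** Serves to place every integer below some term of [alpha]. *)
Lemma alphaS_gt (m : nat) : m%:Z < alpha m.+1.
Proof.
suff: m%:Z < alpha m.+1 /\ m.+1%:Z < alpha m.+2 by case.
elim: m => // m [IH1 IH2]; split=> //.
have p : 1 <= 2 ^+ m :> int by rewrite exprn_ege1.
by rewrite alphaSS exprS; lia.
Qed.

(** Induction on pairs of consecutive lengths: append 0 to a string of length [m.+1], or a nonzero
    digit and then 0 to one of length [m]. The empty string qualifies at length 0 through the
    default of [last]. *)
Lemma naf_exists (m : nat) (r : int) : `|r| < alpha m ->
  exists s, [/\ naf r s, size s = m & last 0 s = 0].
Proof.
suff H : (forall r : int, `|r| < alpha m ->
           exists s, [/\ naf r s, size s = m & last 0 s = 0])
      /\ (forall r : int, `|r| < alpha m.+1 ->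
           exists s, [/\ naf r s, size s = m.+1 & last 0 s = 0]).
  exact: (H.1 r).
clear r; elim: m => [|m [IH0 IH1]].
  split=> r rlt; have -> : r = 0 by move: rlt; rewrite ?alphaS /alpha; lia.
    by exists [::]; split=> //; exact: naf_nil.
  exists [:: 0]; split=> //.
  have /(_ 0) := naf_rcons naf_nil.
  by rewrite mul0r addr0; apply; [right; left | left].
have pad0 (r : int) (s : seq int) : naf r s -> naf r (rcons s 0).
  move=> ns; rewrite -[r]addr0 -[X in r + X](mul0r (2 ^+ size s)).
  by apply: naf_rcons => //; [right; left | left].
split=> // r rlt.
have [rlt1|rge] := ltP `|r| (alpha m.+1).
  have [s [ns ss ls]] := IH1 _ rlt1.
  exists (rcons s 0); split; [exact: pad0| |exact: last_rcons].
  by rewrite size_rcons ss.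
(* [d] is the sign of [r]: from [alpha m.+1 <= |r| < alpha m.+2] the two recursions bound the
   distance of [|r|] to [2 ^+ m]. *)
have [d dd rdlt] : exists2 d : int, d = 1 \/ d = -1 & `|r - d * 2 ^+ m| < alpha m.
  rewrite alphaSS in rlt; rewrite alphaS in rge.
  by case: (ltP 0 r) => r0; [exists 1 | exists (-1)]; [left| lia | right | lia].
have [s [ns ss ls]] := IH0 _ rdlt.
exists (rcons (rcons s d) 0); split; last exact: last_rcons.
  apply: pad0; rewrite -[r](subrK (d * 2 ^+ m)) -{2}ss.
  by apply: naf_rcons => //; [lia | right].
by rewrite !size_rcons ss.
Qed.

(** * Zeros of [2 ^+ m + r] read off a NAF of [r] *)

Lemma reduced_naf_rcons1 (m : nat) (r : int) (s : seq int) :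
  naf r s -> size s = m -> last 0 s = 0 ->
  reduced_naf (2 ^+ m + r) = rcons s 1 /\ naf (2 ^+ m + r) (rcons s 1).
Proof.
move=> ns ss ls.
have n1 : naf (2 ^+ m + r) (rcons s 1).
  rewrite addrC -[2 ^+ m]mul1r -ss.
  by apply: naf_rcons => //; [left | right].
by split=> //; apply: reduced_naf_unique; split=> //; rewrite last_rcons.
Qed.

Lemma count_mem_rcons (T : eqType) (x d : T) (s : seq T) :
  count_mem x (rcons s d) = (count_mem x s + (d == x))%N.
Proof. by rewrite -cats1 count_cat /= addn0. Qed.

(** The reduced NAF [rcons s 1] is itself optimal, and its leading 1 adds no zero. *)
Lemma Z_naf (m : nat) (r : int) (s : seq int) :
  naf r s -> size s = m -> last 0 s = 0 -> Z (2 ^+ m + r) = count_mem 0 s.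
Proof.
move=> ns ss ls; have [e [b1 _]] := reduced_naf_rcons1 ns ss ls.
rewrite (@Z_optimal _ (rcons s 1)); last by rewrite /optimal /naf_bitlength /= e.
by rewrite count_mem_rcons addn0.
Qed.

Lemma Z_pow_sub (m : nat) (r : int) : `|r| < alpha m ->
  Z (2 ^+ m - r) = Z (2 ^+ m + r).
Proof.
move=> /naf_exists[s [ns ss ls]]; rewrite (@Z_naf m r s) //.
rewrite (Z_naf (naf_opp ns)) ?size_map //.
  by rewrite count_map; apply: eq_count => d /=; rewrite oppr_eq0.
by rewrite -(oppr0 int) last_map ls.
Qed.

Lemma Z_powS (m : nat) (r : int) : `|r| < alpha m ->
  Z (2 ^+ m.+1 + r) = (Z (2 ^+ m + r)).+1.
Proof.
move=> /naf_exists[s [ns ss ls]]; rewrite (@Z_naf m r s) //.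
have /(_ 0) := naf_rcons ns; rewrite mul0r addr0 => n0.
rewrite (@Z_naf m.+1 r (rcons s 0)) ?size_rcons ?ss ?last_rcons //.
  by rewrite count_mem_rcons addn1.
by apply: n0; [right; left | left].
Qed.

Lemma Z_powSS (m : nat) (r : int) : `|r| < alpha m ->
  Z (2 ^+ m.+2 + (2 ^+ m + r)) = (Z (2 ^+ m + r)).+1.
Proof.
move=> /naf_exists[s [ns ss ls]]; rewrite (@Z_naf m r s) //.
have [_ n1] := reduced_naf_rcons1 ns ss ls.
have /(_ 0) := naf_rcons n1; rewrite mul0r addr0 => n0.
rewrite (@Z_naf m.+2 _ (rcons (rcons s 1) 0)) ?size_rcons ?ss ?last_rcons //.
  by rewrite !count_mem_rcons addn0 addn1.
by apply: n0; [right; left | left].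
Qed.

(** * The sets [NAFI k] as intervals *)

Lemma naf_bitlength_alpha (m : nat) (n : int) :
  alpha m.+1 <= n < alpha m.+2 -> naf_bitlength n = m.+1.
Proof.
move=> nI; have /naf_exists[s [ns ss ls]] : `|n - 2 ^+ m| < alpha m.
  by move: nI; rewrite alphaSS alphaS; lia.
have [e _] := reduced_naf_rcons1 ns ss ls.
by rewrite /naf_bitlength -[n](subrKC (2 ^+ m)) e size_rcons ss.
Qed.

Lemma NAFI_alpha (m : nat) :
  NAFI m.+1 = [set n | alpha m.+1 <= n < alpha m.+2].
Proof.
apply/seteqP; split=> n /=; last first.
  move=> nI; split; last exact: naf_bitlength_alpha.
  by have := alpha_bounds m.+1; lia.
move=> [n0 nk].
have ex : exists i, n < alpha i by exists `|n|.+1; have := alphaS_gt `|n|; lia.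
(* The least index with [n < alpha i] is at least 2, as [alpha 0 = alpha 1 = 1]; minimality then
   puts [n] in one of the intervals. *)
have := ex_minnP ex; case=> -[|[|i]] ni imin.
- by move: ni; rewrite ?alphaS /alpha; lia.
- by move: ni; rewrite ?alphaS /alpha; lia.
have nI : alpha i.+1 <= n < alpha i.+2.
  rewrite ni andbT leNgt; apply/negP => /imin; by rewrite ltnn.
by move: nk; rewrite (naf_bitlength_alpha nI) => -[<-].
Qed.

Lemma a_alpha (m : nat) : a_ m.+1 = alpha m.+1.
Proof.
have lt12 := alphaS_lt m.
rewrite /a_ NAFI_alpha; apply: xget_unique.
  split=> [|n] /=; first by rewrite lexx.
  by case/andP.
move=> n [/= /andP[n1 _] /(_ (alpha m.+1))].
by rewrite /= lexx lt12 => /(_ isT) n2; apply/eqP; rewrite eq_le n1 n2.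
Qed.

Lemma cardI_alpha (m : nat) : (cardI m.+1)%:Z = alpha m.+2 - alpha m.+1.
Proof.
have lt12 := alphaS_lt m.
have [N defN] : exists N : nat, alpha m.+2 - alpha m.+1 = N%:Z.
  by exists `|alpha m.+2 - alpha m.+1|%N; lia.
rewrite defN; congr Posz; rewrite /cardI.
have -> : NAFI m.+1 = [set alpha m.+1 + i%:Z | i in `I_N].
  rewrite NAFI_alpha; apply/seteqP; split=> n /=.
    by move=> nI; exists `|n - alpha m.+1|%N; lia.
  by move=> [i iN <-]; lia.
rewrite fset_set_image; last exact: finite_II.
rewrite card_imfset; last by move=> i j /addrI[].
by rewrite fset_set_II card_imfset ?size_enum_ord //; exact: val_inj.
Qed.

Theorem mainTheorem4 (k : nat) (v u : int)
    (hk : (3 <= k)%N)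
    (hv0 : 0 <= v) (hv : v < (cardI (k - 2))%:Z)
    (hu0 : 0 <= u) (hu : u <= 2 ^+ (k - 1) - b_ k) :
  [/\ Z (a_ k + v) = (Z (a_ (k - 2) + v)).+1,
      Z (b_ k + u) = (Z (a_ (k - 1) + u)).+1,
      Z (2 ^+ k - (b_ k + u)) = (Z (a_ (k - 1) + u)).+1
    & Z (c_ k + v) = (Z (2 ^+ (k - 2) - (a_ (k - 2) + v))).+1].
Proof.
case: k hk hv hu => [|[|[|m]]] // _; rewrite /c_ /b_.
have -> : (m.+3 - 2 = m.+1)%N by lia.
have -> : (m.+3 - 1 = m.+2)%N by lia.
rewrite !a_alpha !cardI_alpha !alphaSS alphaS !exprS.
set p : int := 2 ^+ m => hv hu.
have am := alpha_bounds m.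
(* a_(k-2) + v = 2^m + r and a_(k-1) + u = 2^(m+1) - q *)
set r := v + 1 - alpha m; set q := p - alpha m - u.
have rlt : `|r| < alpha m by rewrite /r; lia.
have nrlt : `|- r| < alpha m by rewrite normrN.
(* The upper bound on [u] amounts to [0 <= q], and [0 <= u] bounds [q] above. *)
have qlt : `|q| < alpha m.+1 by rewrite alphaS /q -/p; lia.
have nqlt : `|- q| < alpha m.+1 by rewrite normrN.
have qlt2 : `|q| < alpha m.+2 by exact: lt_trans (alphaS_lt m).
have prlt (x : int) : `|x| < alpha m -> `|2 ^+ m + x| < alpha m.+2.
  by rewrite alphaSS -/p; lia.
have ZS := Z_pow_sub rlt.
have ZQ := Z_powS nqlt.
split.
(* Reflect about [2 ^+ m.+2], strip the leading digits 1 0, then reflect about [2 ^+ m]. *)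
- transitivity (Z (2 ^+ m.+2 - (2 ^+ m - r))).
    by congr Z; rewrite !exprS -/p /r; lia.
  rewrite Z_pow_sub ?prlt // Z_powSS // ZS; congr (Z _).+1.
  by rewrite -/p /r; lia.
- transitivity (Z (2 ^+ m.+2 - q)); first by congr Z; rewrite !exprS -/p /q; lia.
  by rewrite ZQ; congr (Z _).+1; rewrite !exprS -/p /q; lia.
(* The mirror image about [2 ^+ m.+2] of the number in the previous case. *)
- transitivity (Z (2 ^+ m.+2 + q)); first by congr Z; rewrite !exprS -/p /q; lia.
  rewrite -(Z_pow_sub qlt2) ZQ.
  by congr (Z _).+1; rewrite !exprS -/p /q; lia.
(* As in the first case, but without the outer reflection. *)
- transitivity (Z (2 ^+ m.+2 + (2 ^+ m + r))).
    by congr Z; rewrite !exprS -/p /r; lia.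
  rewrite Z_powSS // -ZS; congr (Z _).+1.
  by rewrite -/p /r; lia.
Qed.
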